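(* Let $G_1,G_2,G_k$ be generators over $\Sigma_1,\Sigma_2,\Sigma_k$, respectively, with $\Sigma_1\cap\Sigma_2\subseteq\Sigma_k\subseteq\Sigma_1\cup\Sigma_2$, and put $L=L(G_1\| G_2\| G_k)$. Let $K\subseteq L_m(G_1\| G_2\| G_k)$ be a specification such that both $K$ and its prefix closure $\overline{K}$ are conditionally decomposable with respect to $\Sigma_1,\Sigma_2,\Sigma_k$. Define \[ \sup CN_k=\sup CN(P_k(K),L(G_k),\Sigma_{k,u},Q_k),\qquad \sup CN_{i+k}=\sup CN\big(P_{i+k}(K),\,L(G_i)\parallel\overline{\sup CN_k},\,\Sigma_{i+k,u},\,Q_{i+k}\big),\quad i=1,2. \] If $\sup CN_k\subseteq P^{i+k}_k(\sup CN_{i+k})$ for $i=1,2$, then \[ \sup CN_{1+k}\parallel\sup CN_{2+k}=\sup cCN\big(K,L,(\Sigma_{1,u},\Sigma_{2,u},\Sigma_{k,u}),(Q_{1+k},Q_{2+k},Q_k)\big). \]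
   Context: An event set is a finite nonempty set $\Sigma$; a language over $\Sigma$ is a subset of the set $\Sigma^*$ of finite words, and the specification $K$ is a regular language. $\overline{L}$ denotes the prefix closure of $L$. A generator over $\Sigma$ is $G=(Q,\Sigma,f,q_0,Q_m)$ with finite nonempty state set $Q$, partial transition function $f:Q\times\Sigma\to Q$ (extended to words), initial state $q_0$, marked states $Q_m\subseteq Q$; $L(G)=\{s\in\Sigma^*: f(q_0,s)\text{ is defined}\}$ and $L_m(G)=\{s\in\Sigma^*: f(q_0,s)\in Q_m\}$. For $\Sigma_0\subseteq\Sigma$, the projection $\Sigma^*\to\Sigma_0^*$ is the homomorphism erasing events outside $\Sigma_0$ and fixing those in $\Sigma_0$. For $L_i\subseteq\Sigma_i^*$, $L_1\parallel L_2=\{w\in(\Sigma_1\cup\Sigma_2)^*: P_i(w)\in L_i,\ i=1,2\}$, where $P_i$ is the projection to $\Sigma_i^*$. $G_1\|G_2$ is the parallel composition, with $L(G_1\|G_2)=L(G_1)\parallel L(G_2)$ and $L_m(G_1\|G_2)=L_m(G_1)\parallel L_m(G_2)$. The set $\Sigma_1\cup\Sigma_2$ is partitioned into controllable events $\Sigma_c$ and uncontrollable events $\Sigma_u$, and $\Sigma_o\subseteq\Sigma_1\cup\Sigma_2$ is the set of observable events. Notation, for $i=1,2$: $\Sigma_{i+k}=\Sigma_i\cup\Sigma_k$; for $j\in\{1,2,k,1+k,2+k\}$, $\Sigma_{j,u}=\Sigma_j\cap\Sigma_u$ and $\Sigma_{j,o}=\Sigma_j\cap\Sigma_o$; $P_k:(\Sigma_1\cup\Sigma_2)^*\to\Sigma_k^*$,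 $P_{i+k}:(\Sigma_1\cup\Sigma_2)^*\to\Sigma_{i+k}^*$, $P^{i+k}_k:\Sigma_{i+k}^*\to\Sigma_k^*$ and $Q_j:\Sigma_j^*\to\Sigma_{j,o}^*$, $j\in\{1+k,2+k,k\}$, are projections. $K$ is conditionally decomposable with respect to $\Sigma_1,\Sigma_2,\Sigma_k$ if $K=P_{1+k}(K)\parallel P_{2+k}(K)$. A language $M$ is controllable with respect to prefix-closed $L$ and $\Sigma'_u$ if $\overline{M}\Sigma'_u\cap L\subseteq\overline{M}$. $M$ is normal with respect to prefix-closed $L$ and a projection $Q$ if $\overline{M}=Q^{-1}Q(\overline{M})\cap L$. $\sup CN(K,L,\Sigma'_u,Q)$ denotes the supremal controllable and normal sublanguage of $K$: the union (which itself has both properties) of all $M\subseteq K\cap L$ that are controllable with respect to $L$ and $\Sigma'_u$ and normal with respect to $L$ and $Q$. A language $M\subseteq L_m(G_1\|G_2\|G_k)$ is conditionally controllable if $P_k(M)$ is controllable with respect to $L(G_k)$ and $\Sigma_{k,u}$, and for $i=1,2$, $P_{i+k}(M)$ is controllable with respect to $L(G_i)\parallel\overline{P_k(M)}$ and $\Sigma_{i+k,u}$. It is conditionally normal if $P_k(M)$ is normal with respect to $L(G_k)$ and $Q_k$, and for $i=1,2$, $P_{i+k}(M)$ is normal with respect to $L(G_i)\parallel\overline{P_k(M)}$ and $Q_{i+k}$. $\sup cCN(K,L,(\Sigma_{1,u},\Sigma_{2,u},\Sigma_{k,u}),(Q_{1+k},Q_{2+k},Q_k))$ is the supremal conditionally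 controllable and conditionally normal sublanguage of $K$, i.e. the union (which itself has both properties) of all $M\subseteq K$ that are both conditionally controllable and conditionally normal. *)

(* Defs.v *)
From HB Require Import structures.
From mathcomp Require Import all_boot.
From mathcomp Require Import boolp classical_sets.

Set Implicit Arguments.
Unset Strict Implicit.
Unset Printing Implicit Defensive.

Local Open Scope set_scope.
Local Open Scope classical_set_scope.

(* All event sets are finite subsets of one ambient finite type E.  A language
   over S : {set E} is a classical set of words whose letters all lie in S. *)
Section Languages.
Variable E : finType.
Implicit Types (S : {set E}) (L M K : set (seq E)) (w s t : seq E).

Definition words S : set (seq E) := [set w | all (mem S) w].

Definition prefix_closure L : set (seq E) := [set s | exists t, L (s ++ t)].

(* Erasure of the events outside S0.  The same function serves as the
   projection S^* -> S0^* for every S containing S0; where the domain S matters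
   (inverse images), it is given explicitly, as in [normal]. *)
Definition proj S0 w : seq E := [seq e <- w | e \in S0].

Definition par_lang S1 S2 L1 L2 : set (seq E) :=
  [set w | [/\ words (S1 :|: S2) w, L1 (proj S1 w) & L2 (proj S2 w)]].

Definition cond_decomposable S1 S2 Sk K : Prop :=
  K = par_lang (S1 :|: Sk) (S2 :|: Sk)
        (proj (S1 :|: Sk) @` K) (proj (S2 :|: Sk) @` K).

Definition controllable L (Su : {set E}) M : Prop :=
  [set rcons s u | s in prefix_closure M & u in [set e | e \in Su]] `&` L
    `<=` prefix_closure M.

(* Normality with respect to L and the projection Q : S^* -> So^*. *)
Definition normal S L (So : {set E}) M : Prop :=
  prefix_closure M =
    (words S `&` proj So @^-1` (proj So @` prefix_closure M)) `&` L.

(* Supremal sublanguage for K, L over S, uncontrollable events Su and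
   Q : S^* -> So^*. *)
Definition supCN S K L (Su So : {set E}) : set (seq E) :=
  \bigcup_(M in [set M | [/\ M `<=` K `&` L, controllable L Su M
                           & normal S L So M]]) M.

End Languages.

Section Generators.
Variable E : finType.

(* [trans q e = None] means that the transition is undefined. *)
Record generator (S : {set E}) := Generator {
  state : finType;
  trans : state -> E -> option state;
  init : state;
  marked : {set state};
  trans_dom : forall q e, e \notin S -> trans q e = None }.

Fixpoint run (S : {set E}) (G : generator S) (q : state G) (w : seq E) :
    option (state G) :=
  if w is e :: w' then obind (fun q' => run q' w') (trans q e) else Some q.

Definition gen_lang (S : {set E}) (G : generator S) : set (seq E) :=
  [set w | exists q, run (init G) w = Some q].

Definition marked_lang (S : {set E}) (G : generator S) : set (seq E) :=
  [set w | exists2 q, q \in marked G & run (init G) w = Some q].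

Definition regular (S : {set E}) (K : set (seq E)) : Prop :=
  exists G : generator S, K = marked_lang G.

Section Parallel.
Variables (S1 S2 : {set E}) (G1 : generator S1) (G2 : generator S2).

Definition par_trans (q : state G1 * state G2) (e : E) :
    option (state G1 * state G2) :=
  match e \in S1, e \in S2 with
  | true, true =>
      obind (fun q1 => omap (pair q1) (trans q.2 e)) (trans q.1 e)
  | true, false => omap (fun q1 => (q1, q.2)) (trans q.1 e)
  | false, true => omap (fun q2 => (q.1, q2)) (trans q.2 e)
  | false, false => None
  end.

Lemma par_trans_dom q e : e \notin S1 :|: S2 -> par_trans q e = None.
Proof. by rewrite /par_trans inE; case: (e \in S1); case: (e \in S2). Qed.

Definition par_gen : generator (S1 :|: S2) :=
  @Generator (S1 :|: S2) (state G1 * state G2)%type par_trans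
    (init G1, init G2) (finset.setX (marked G1) (marked G2)) par_trans_dom.

Lemma run_par q1 q2 w r1 r2 :
  @run _ par_gen (q1, q2) w = Some (r1, r2) <->
  [/\ words (S1 :|: S2) w, run q1 (proj S1 w) = Some r1
    & run q2 (proj S2 w) = Some r2].
Proof.
rewrite /words /=; elim: w q1 q2 => [|e w IHw] q1 q2 /=.
  by split=> [[-> ->]|[_ [->] [->]]].
rewrite /par_trans inE.
case: (e \in S1); case: (e \in S2) => //=; last by split=> // -[].
- case: (trans q1 e) => [p1|] /=; last by split=> // -[].
  by case: (trans q2 e) => [p2|] /=; [exact: IHw | split=> // -[]].
- by case: (trans q1 e) => [p1|] /=; [exact: IHw | split=> // -[]].
- by case: (trans q2 e) => [p2|] /=; [exact: IHw | split=> // -[]].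
Qed.

Lemma gen_lang_par :
  gen_lang par_gen = par_lang S1 S2 (gen_lang G1) (gen_lang G2).
Proof.
apply/seteqP; split=> w.
  by move=> [[r1 r2] /run_par[Sw w1 w2]]; split=> //; [exists r1 | exists r2].
by move=> [Sw [r1 w1] [r2 w2]]; exists (r1, r2); apply/run_par.
Qed.

Lemma marked_lang_par :
  marked_lang par_gen = par_lang S1 S2 (marked_lang G1) (marked_lang G2).
Proof.
apply/seteqP; split=> w.
  move=> [[r1 r2]]; rewrite finset.in_setX => /andP[/= m1 m2] /run_par[Sw w1 w2].
  by split=> //; [exists r1 | exists r2].
move=> [Sw [r1 m1 w1] [r2 m2 w2]]; exists (r1, r2); last exact/run_par.
by rewrite finset.in_setX m1 m2.
Qed.

End Parallel.

Section Conditional.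
Variables (S1 S2 Sk : {set E}).
Variables (G1 : generator S1) (G2 : generator S2) (Gk : generator Sk).
Implicit Types (M K : set (seq E)).

Definition cond_controllable (Su : {set E}) M : Prop :=
  [/\ M `<=` marked_lang (par_gen (par_gen G1 G2) Gk),
      controllable (gen_lang Gk) (Sk :&: Su) (proj Sk @` M),
      controllable
        (par_lang S1 Sk (gen_lang G1) (prefix_closure (proj Sk @` M)))
        ((S1 :|: Sk) :&: Su) (proj (S1 :|: Sk) @` M)
    & controllable
        (par_lang S2 Sk (gen_lang G2) (prefix_closure (proj Sk @` M)))
        ((S2 :|: Sk) :&: Su) (proj (S2 :|: Sk) @` M)].

Definition cond_normal (So : {set E}) M : Prop :=
  [/\ M `<=` marked_lang (par_gen (par_gen G1 G2) Gk),
      normal Sk (gen_lang Gk) (Sk :&: So) (proj Sk @` M),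
      normal (S1 :|: Sk)
        (par_lang S1 Sk (gen_lang G1) (prefix_closure (proj Sk @` M)))
        ((S1 :|: Sk) :&: So) (proj (S1 :|: Sk) @` M)
    & normal (S2 :|: Sk)
        (par_lang S2 Sk (gen_lang G2) (prefix_closure (proj Sk @` M)))
        ((S2 :|: Sk) :&: So) (proj (S2 :|: Sk) @` M)].

(* The plant language L(G1 || G2 || Gk), the local uncontrollable event sets
   and the local observation projections are not separate arguments: they are
   determined by G1, G2, Gk, Su and So. *)
Definition supcCN K (Su So : {set E}) : set (seq E) :=
  \bigcup_(M in [set M | [/\ M `<=` K, cond_controllable Su M
                           & cond_normal So M]]) M.

End Conditional.
End Generators.

(* Main.v *)
Require Import Defs.
From mathcomp Require Import all_boot.
From mathcomp Require Import boolp classical_sets.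

Set Implicit Arguments.
Unset Strict Implicit.
Unset Printing Implicit Defensive.

Local Open Scope set_scope.
Local Open Scope classical_set_scope.

(** Write cl for the prefix closure, C_k, C_1 and C_2 for the three supremal
    languages of the statement, and P_k, P_(i+k) for the projections.

    The synthesized language C_1 || C_2 is admissible because composing loses
    nothing: its projections are exactly C_k, C_1 and C_2.  Indeed
    controllability and normality of a language depend on its closure only, so
    maximality forces C_k to contain every word of P_k(K) lying in cl(C_k)
    ([supCN_relatively_closed]).  As C_i is a part of P_(i+k)(K) whose
    projection to Sk stays in cl(C_k), this gives P_k(C_i) `<=` C_k; the
    hypothesis is the converse inclusion.  Hence P_k(C_1) = P_k(C_2) = C_k, and
    since the two local alphabets share exactly Sk, every word of C_1 can be
    interleaved with some word of C_2 ([glue], [proj_par_lang]).  The conditions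
    required of the projections of C_1 || C_2 are then those that C_k, C_1
    and C_2 have as supremal languages.

    Conversely, let M be an admissible part of K.  Then P_k(M) `<=` C_k by
    maximality, but P_(i+k)(M) has its properties relative to the plant
    L(G_i) || cl(P_k(M)), whereas C_i is defined over the larger plant
    L(G_i) || cl(C_k).  The properties of P_k(M) over L(G_k) bridge the gap
    ([controllable_par_widen], [normal_par_widen]), so P_(i+k)(M) `<=` C_i.
    Conditional decomposability of K is used to return from the projections
    to K. *)

(** * Projections, prefix closures and parallel composition *)

Section Words.
Context {E : finType}.
Implicit Types (A B S T : {set E}) (L M K : set (seq E)) (w s t : seq E).

Definition prefix_closed L := prefix_closure L `<=` L.

Lemma words_proj S w : words S (proj S w).
Proof. exact: filter_all. Qed.

Lemma proj_cat S s t : proj S (s ++ t) = proj S s ++ proj S t.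
Proof. exact: filter_cat. Qed.

Lemma proj_proj S T w : S \subset T -> proj S (proj T w) = proj S w.
Proof.
move=> /fintype.subsetP ST; rewrite /proj -filter_predI; apply: eq_filter => e /=.
by case Se: (e \in S) => //=; rewrite (ST _ Se).
Qed.

Lemma image_proj_proj S T M :
  S \subset T -> proj S @` (proj T @` M) = proj S @` M.
Proof.
by move=> ST; rewrite image_comp; apply: eq_imagel => w _; exact: proj_proj.
Qed.

Lemma sub_closure M : M `<=` prefix_closure M.
Proof. by move=> w Mw; exists [::]; rewrite cats0. Qed.

Lemma closure_mono M K : M `<=` K -> prefix_closure M `<=` prefix_closure K.
Proof. by move=> MK s [t /MK Kst]; exists t. Qed.

Lemma closure_closed M : prefix_closed (prefix_closure M).
Proof. by move=> s [t [r Mr]]; exists (t ++ r); rewrite catA. Qed.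

Lemma words_closed S : prefix_closed (words S).
Proof. by move=> s [t]; rewrite /words /= all_cat => /andP[]. Qed.

Lemma sub_prefix_closed M L :
  prefix_closed L -> M `<=` L -> prefix_closure M `<=` L.
Proof. by move=> cL ML s /(closure_mono ML)/cL. Qed.

Lemma par_lang_closed S T L M :
  prefix_closed L -> prefix_closed M -> prefix_closed (par_lang S T L M).
Proof.
move=> cL cM s [t [/= wst]]; rewrite !proj_cat => Ls Ms; split.
- by apply: words_closed; exists t.
- by apply: cL; exists (proj S t).
- by apply: cM; exists (proj T t).
Qed.

Lemma par_langC S T L M : par_lang S T L M = par_lang T S M L.
Proof.
by apply/seteqP; split=> w [/= ww ? ?]; split; rewrite // finset.setUC.
Qed.

(** Letters private to [A] or to [B] can be emitted at once; when neither word
    starts with a private letter, both start with the same shared letter. *)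
Lemma glue A B s t : words A s -> words B t ->
  proj (A :&: B) s = proj (A :&: B) t ->
  exists w, [/\ words (A :|: B) w, proj A w = s & proj B w = t].
Proof.
rewrite /words /=.
elim: s t => [|a s IHs] t.
  move=> _; elim: t => [|b t IHt]; first by exists [::].
  rewrite /= finset.in_setI => /andP[Bb Bt]; rewrite Bb andbT.
  case Ab: (b \in A) => // /(IHt Bt)[w [ww wA wB]].
  by exists (b :: w); rewrite /= finset.in_setU Ab Bb wA wB.
move=> /= /andP[Aa As]; case Ba: (a \in B); last first.
  rewrite finset.in_setI Ba andbF => Bt /(IHs _ As Bt)[w [ww wA wB]].
  by exists (a :: w); rewrite /= finset.in_setU Aa Ba wA wB.
rewrite finset.in_setI Aa Ba /=; elim: t => [//|b t IHt].
rewrite /= finset.in_setI => /andP[Bb Bt]; rewrite Bb andbT.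
case Ab: (b \in A); last first.
  move=> /(IHt Bt)[w [ww wA wB]].
  by exists (b :: w); rewrite /= finset.in_setU Ab Bb wA wB.
move=> [<- /(IHs _ As Bt)[w [ww wA wB]]].
by exists (a :: w); rewrite /= finset.in_setU Aa Ba wA wB.
Qed.

(** Under the inclusion of shared projections, every word of [L] finds in [M] a
    partner to be glued with, so synchronization with [M] does not restrict
    [L]. *)
Lemma proj_par_lang A B L M : L `<=` words A -> M `<=` words B ->
  proj (A :&: B) @` L `<=` proj (A :&: B) @` M ->
  proj A @` par_lang A B L M = L.
Proof.
move=> LA MB LM; apply/seteqP; split=> [_ [w [_ Lw _] <-] //|s Ls].
have [t Mt ts] : (proj (A :&: B) @` M) (proj (A :&: B) s) by apply: LM; exists s.
have [w [ww wA wB]] := glue (LA _ Ls) (MB _ Mt) (esym ts).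
by exists w => //; split; rewrite ?wA ?wB.
Qed.

End Words.

(** * Controllability, normality and the supremal sublanguage *)

Section Supremal.
Context {E : finType}.
Implicit Types (S Su So : {set E}) (L M K : set (seq E)).

Lemma controllable_closure L Su M K : prefix_closure M = prefix_closure K ->
  controllable L Su M -> controllable L Su K.
Proof. by rewrite /controllable => ->. Qed.

Lemma normal_closure S L So M K : prefix_closure M = prefix_closure K ->
  normal S L So M -> normal S L So K.
Proof. by rewrite /normal => ->. Qed.

Lemma normalP S L So M : normal S L So M <->
  [/\ prefix_closure M `<=` words S, prefix_closure M `<=` L &
      forall s t, prefix_closure M s -> words S t -> L t ->
        proj So s = proj So t -> prefix_closure M t].
Proof.
split=> [nM|[MS ML nM]].
  split=> [s|s|s t Ms St Lt st]; rewrite nM; [by move=> [[]] | by move=> [] |].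
  by split=> //; split=> //; exists s.
apply/seteqP; split=> [s Ms|t [[St [s Ms st]] Lt]]; last exact: (nM s).
by split; [split; [exact: MS | exists s] | exact: ML].
Qed.

Lemma closure_bigcup (F : set (set (seq E))) :
  prefix_closure (\bigcup_(M in F) M) = \bigcup_(M in F) prefix_closure M.
Proof.
apply/seteqP; split=> s.
  by move=> [t [M FM Mst]]; exists M => //; exists t.
by move=> [M FM [t Mst]]; exists t, M.
Qed.

Lemma supCN_subl S K L Su So : supCN S K L Su So `<=` K.
Proof. by move=> w [M [MKL _ _] /MKL[]]. Qed.

Lemma supCN_subr S K L Su So : supCN S K L Su So `<=` L.
Proof. by move=> w [M [MKL _ _] /MKL[]]. Qed.

Lemma supCN_max S K L Su So M : M `<=` K -> M `<=` L ->
  controllable L Su M -> normal S L So M -> M `<=` supCN S K L Su So.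
Proof.
by move=> MK ML cM nM w Mw; exists M => //; split=> // s Ms; split; auto.
Qed.

Lemma supCN_controllable S K L Su So :
  controllable L Su (supCN S K L Su So).
Proof.
rewrite /controllable closure_bigcup => _ [[s [M FM Ms] [u Suu <-]] Lsu].
exists M => //; have [_ cM _] := FM.
by apply: cM; split=> //; exists s => //; exists u.
Qed.

Lemma supCN_normal S K L Su So : normal S L So (supCN S K L Su So).
Proof.
apply/normalP; rewrite closure_bigcup; split=> [s|s|s t].
- by move=> [M [_ _ /normalP[MS _ _]] /MS].
- by move=> [M [_ _ /normalP[_ ML _]] /ML].
move=> [M FM Ms] St Lt st; exists M => //; have [_ _ /normalP[_ _ nM]] := FM.
exact: (nM s).
Qed.

(** Adding to the supremal language words of [K] that are already prefixes of
    its members leaves the closure unchanged, so nothing new is added. *)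
Lemma supCN_relatively_closed S K L Su So :
  K `&` prefix_closure (supCN S K L Su So) `<=` supCN S K L Su So.
Proof.
set C := supCN S K L Su So.
have CE : prefix_closure C = prefix_closure (K `&` prefix_closure C).
  apply/seteqP; split.
    apply: closure_mono => w Cw.
    by split; [exact: supCN_subl Cw | exact: sub_closure].
  by apply: sub_prefix_closed; [exact: closure_closed | move=> w []].
have nC : normal S L So C by exact: supCN_normal.
apply: supCN_max.
- by move=> w [].
- by have /normalP[_ CL _] := nC; move=> w [_ /CL].
- by apply: (controllable_closure CE); exact: supCN_controllable.
- exact: (normal_closure CE).
Qed.

End Supremal.

(** * Enlarging the coordinator part of a local plant *)

Section Widen.
Context {E : finType}.
Variables (Si Sk : {set E}) (Li Lk C M N : set (seq E)).
Hypothesis C_sub : C `<=` Lk.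

(** If the enabled event lies in [Sk], controllability of [N] keeps the
    projection to [Sk] inside the closure of [N]; otherwise that projection does
    not change.  Either way the extended word is still in the smaller plant. *)
Lemma controllable_par_widen (Su : {set E}) :
  controllable Lk (Sk :&: Su) N ->
  prefix_closure M `<=` par_lang Si Sk Li (prefix_closure N) ->
  controllable (par_lang Si Sk Li (prefix_closure N)) ((Si :|: Sk) :&: Su) M ->
  controllable (par_lang Si Sk Li C) ((Si :|: Sk) :&: Su) M.
Proof.
move=> cN MN cM _ [[s Ms [u Suu <-]] [wsu isu ksu]].
apply: cM; split; first by exists s => //; exists u.
split=> //; have [_ _ Ns] := MN _ Ms; move: ksu Suu => /=.
rewrite /proj filter_rcons -/(proj Sk s); case: ifP => // ku /C_sub Lksu.
rewrite finset.in_setI => /andP[_ Suu]; apply: cN; split=> //.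
by exists (proj Sk s) => //; exists u; rewrite //= finset.in_setI ku.
Qed.

(** Words with equal observations have projections to [Sk] with equal
    observations, so normality of [N] brings every look-alike of a word of [M]
    back into the smaller plant. *)
Lemma normal_par_widen (So : {set E}) :
  prefix_closure N `<=` C ->
  normal Sk Lk (Sk :&: So) N ->
  normal (Si :|: Sk) (par_lang Si Sk Li (prefix_closure N))
    ((Si :|: Sk) :&: So) M ->
  normal (Si :|: Sk) (par_lang Si Sk Li C) ((Si :|: Sk) :&: So) M.
Proof.
move=> NC /normalP[_ _ nN] /normalP[MS ML nM]; apply/normalP; split=> //.
  by move=> s /ML[? ? /NC]; split.
move=> s t Ms St [_ it kt] st; apply: (nM s) => //; split=> //.
have [_ _ Ns] := ML _ Ms.
apply: (nN (proj Sk s)) => //; first exact: words_proj.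
  exact: C_sub.
have kio : Sk :&: So \subset (Si :|: Sk) :&: So.
  by apply: finset.setSI; exact: finset.subsetUr.
rewrite !proj_proj ?finset.subsetIl //.
by rewrite -(proj_proj s kio) st proj_proj.
Qed.

End Widen.

(** * Supremality of the composed language *)

Section Generators.
Context {E : finType}.

Lemma run_cat (S : {set E}) (G : generator S) (q : state G) s t :
  run q (s ++ t) = obind (fun r => run r t) (run q s).
Proof. by elim: s q => //= e s IHs q; case: (trans q e). Qed.

Lemma gen_lang_closed (S : {set E}) (G : generator S) :
  prefix_closed (gen_lang G).
Proof.
move=> s [t [q]]; rewrite run_cat; case rs: (run _ s) => [r|] //= _.
by exists r.
Qed.

Lemma marked_gen_lang (S : {set E}) (G : generator S) :
  marked_lang G `<=` gen_lang G.
Proof. by move=> w [q _ rw]; exists q. Qed.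

Lemma marked_lang_par3 (S1 S2 Sk : {set E}) (G1 : generator S1)
    (G2 : generator S2) (Gk : generator Sk) w :
  marked_lang (par_gen (par_gen G1 G2) Gk) w ->
  [/\ gen_lang G1 (proj S1 w), gen_lang G2 (proj S2 w)
    & gen_lang Gk (proj Sk w)].
Proof.
rewrite !marked_lang_par => -[_ [_ w1 w2] wk]; split; last exact: marked_gen_lang.
  by move: w1; rewrite proj_proj ?finset.subsetUl // => /marked_gen_lang.
by move: w2; rewrite proj_proj ?finset.subsetUr // => /marked_gen_lang.
Qed.

End Generators.

Section Local.
Context {E : finType}.
Variables (Si Sk Su So : {set E}) (Gi : generator Si) (Gk : generator Sk).
Variable K : set (seq E).
Let Sik := Si :|: Sk.
Let Ck := supCN Sk (proj Sk @` K) (gen_lang Gk) (Sk :&: Su) (Sk :&: So).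
Let Ci := supCN Sik (proj Sik @` K)
  (par_lang Si Sk (gen_lang Gi) (prefix_closure Ck)) (Sik :&: Su) (Sik :&: So).

(** The plant defining [Ci] only bounds this projection by the closure of [Ck];
    the sharper bound comes from [supCN_relatively_closed]. *)
Lemma proj_local_supCN : proj Sk @` Ci `<=` Ck.
Proof.
move=> _ [s Cs <-]; apply: supCN_relatively_closed; split.
  have [w Kw <-] := supCN_subl Cs.
  by rewrite proj_proj ?finset.subsetUr //; exists w.
by have [] := supCN_subr Cs.
Qed.

Lemma local_supCN_max (M : set (seq E)) :
  M `<=` K -> proj Sk @` M `<=` gen_lang Gk -> proj Si @` M `<=` gen_lang Gi ->
  controllable (gen_lang Gk) (Sk :&: Su) (proj Sk @` M) ->
  normal Sk (gen_lang Gk) (Sk :&: So) (proj Sk @` M) ->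
  controllable (par_lang Si Sk (gen_lang Gi) (prefix_closure (proj Sk @` M)))
    (Sik :&: Su) (proj Sik @` M) ->
  normal Sik (par_lang Si Sk (gen_lang Gi) (prefix_closure (proj Sk @` M)))
    (Sik :&: So) (proj Sik @` M) ->
  proj Sik @` M `<=` Ci.
Proof.
move=> MK Mk Mi ck nk ci ni.
have MCk : prefix_closure (proj Sk @` M) `<=` prefix_closure Ck.
  by apply: closure_mono; apply: supCN_max => //; exact: image_subset.
have Ck_sub : prefix_closure Ck `<=` gen_lang Gk.
  apply: sub_prefix_closed; [exact: gen_lang_closed | exact: supCN_subr].
have /normalP[_ Mpar _] := ni.
have nM : normal Sik (par_lang Si Sk (gen_lang Gi) (prefix_closure Ck))
    (Sik :&: So) (proj Sik @` M) by exact: normal_par_widen nk ni.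
apply: supCN_max => //.
- exact: image_subset.
- by have /normalP[_ Mplant _] := nM; move=> s /sub_closure/Mplant.
- exact: controllable_par_widen ck Mpar ci.
Qed.

End Local.

Theorem corollary20 (E : finType) (S1 S2 Sk Sc Su So : {set E})
    (S1_neq0 : S1 != finset.set0) (S2_neq0 : S2 != finset.set0)
    (Sk_neq0 : Sk != finset.set0)
    (S12k : S1 :&: S2 \subset Sk) (Sk12 : Sk \subset S1 :|: S2)
    (Scu_cover : Sc :|: Su = S1 :|: S2) (Scu_disjoint : Sc :&: Su = finset.set0)
    (So12 : So \subset S1 :|: S2)
    (G1 : generator S1) (G2 : generator S2) (Gk : generator Sk)
    (K : set (seq E)) (K_regular : regular (S1 :|: S2) K)
    (K_sub : K `<=` marked_lang (par_gen (par_gen G1 G2) Gk))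
    (K_dec : cond_decomposable S1 S2 Sk K)
    (Kbar_dec : cond_decomposable S1 S2 Sk (prefix_closure K)) :
  let S1k := S1 :|: Sk in
  let S2k := S2 :|: Sk in
  let supCNk :=
    supCN Sk (proj Sk @` K) (gen_lang Gk) (Sk :&: Su) (Sk :&: So) in
  let supCN1k :=
    supCN S1k (proj S1k @` K)
      (par_lang S1 Sk (gen_lang G1) (prefix_closure supCNk))
      (S1k :&: Su) (S1k :&: So) in
  let supCN2k :=
    supCN S2k (proj S2k @` K)
      (par_lang S2 Sk (gen_lang G2) (prefix_closure supCNk))
      (S2k :&: Su) (S2k :&: So) in
  supCNk `<=` proj Sk @` supCN1k ->
  supCNk `<=` proj Sk @` supCN2k ->
  par_lang S1k S2k supCN1k supCN2k =
  supcCN G1 G2 Gk K Su So.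
Proof.
move=> S1k S2k Ck C1 C2 CkC1 CkC2.
have kE : S1k :&: S2k = Sk.
  apply/finset.setP=> e; rewrite !finset.inE.
  have := fintype.subsetP S12k e; rewrite finset.in_setI.
  by case: (e \in S1); case: (e \in S2); case: (e \in Sk) => //= ->.
have C1w : C1 `<=` words S1k by move=> w /supCN_subr[].
have C2w : C2 `<=` words S2k by move=> w /supCN_subr[].
have C1k : proj Sk @` C1 = Ck.
  by apply/seteqP; split=> //; exact: proj_local_supCN.
have C2k : proj Sk @` C2 = Ck.
  by apply/seteqP; split=> //; exact: proj_local_supCN.
pose P := par_lang S1k S2k C1 C2.
have P1 : proj S1k @` P = C1.
  by apply: proj_par_lang => //; rewrite kE C1k C2k.
have P2 : proj S2k @` P = C2.
  rewrite /P par_langC; apply: proj_par_lang => //.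
  by rewrite finset.setIC kE C1k C2k.
have Pk : proj Sk @` P = Ck.
  by rewrite -(@image_proj_proj _ Sk S1k) ?finset.subsetUr // P1.
apply/seteqP; split=> w.
  have PK : P `<=` K.
    move=> s [sw /supCN_subl s1 /supCN_subl s2]; by rewrite K_dec.
  have PL := subset_trans PK K_sub.
  move=> Pw; exists P => //; split=> //; split=> //; rewrite ?P1 ?P2 Pk;
    by [exact: supCN_controllable | exact: supCN_normal].
move=> [M [MK [ML ck c1 c2] [_ nk n1 n2]] Mw].
have M1 : proj S1k @` M `<=` C1.
  by apply: local_supCN_max => // _ [s /ML/marked_lang_par3[? ? ?] <-].
have M2 : proj S2k @` M `<=` C2.
  by apply: local_supCN_max => // _ [s /ML/marked_lang_par3[? ? ?] <-].
split; [|by apply: M1; exists w|by apply: M2; exists w].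
by have := MK _ Mw; rewrite {1}K_dec => -[].
Qed.
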